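(* Let $t\ge 1$ and $n\ge 1$ be integers. If $D\subseteq S_n$ is a $t$-transitive permutation group, then $D$ is a $t$-design in $(S_n,d_S)$. If $D\subseteq S_n$ is a $t$-design in $(S_n,d_S)$ that is a subgroup of $S_n$, then $D$ is a $t$-transitive permutation group.
   Context: $S_n$ is the symmetric group on $n$ letters, acting on $X=\{1,\dots,n\}$. A permutation group on $X$ is $t$-transitive if it acts transitively on the set of $t$-tuples of pairwise distinct elements of $X$. For $\nu\in S_n$ let $F(\nu)$ be its number of fixed points; the metric is $d_S(\sigma,\theta)=n-F(\sigma\theta^{-1})$. For $j\in\{0,\dots,n\}$ let $v_j$ be the number of permutations with exactly $n-j$ fixed points. For nonempty $D\subseteq S_n$, its frequencies are $f_i=|\{(x,y)\in D^2: d_S(x,y)=i\}|/|D|^2$, $i=0,\dots,n$. $D$ is a $t$-design if $\sum_{j=0}^n f_j j^i=\sum_{j=0}^n \frac{v_j}{n!} j^i$ for every $i=1,\dots,t$.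
   Formalization: The second implication assumes t ≤ n: for t > n there are no t-tuples of distinct elements, a group is then taken not to be t-transitive, and S_n is a t-design that is not t-transitive; the first implication is stated for all t, n ≥ 1. *)

(* Defs.v *)
From mathcomp Require Export all_boot all_order all_algebra all_fingroup.
From mathcomp Require Export primitive_action.

Set Implicit Arguments.
Unset Strict Implicit.
Unset Printing Implicit Defensive.

Import GRing.Theory.

Section PermDesign.

Variable n : nat.
Implicit Types (s u : 'S_n) (D : {set 'S_n}).

Definition nfix s : nat := #|[set x : 'I_n | s x == x]|.

(* The subtraction never truncates: nfix is at most n. The product of
   {perm T} composes from left to right, (s * u) x = u (s x); the other
   convention gives the same distance, because s * u^-1 and u^-1 * s are
   conjugate. *)
Definition dS s u : nat := n - nfix (s * u^-1)%g.

Definition nperm_at (j : nat) : nat := #|[set s : 'S_n | nfix s == n - j]|.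

Local Open Scope ring_scope.

Definition freq D (i : nat) : rat :=
  #|[set p : 'S_n * 'S_n | [&& p.1 \in D, p.2 \in D & dS p.1 p.2 == i]]|%:R
  / (#|D| ^ 2)%N%:R.

Definition is_design (t : nat) D : Prop :=
  D != set0 /\
  forall i : nat, (1 <= i <= t)%N ->
    \sum_(j < n.+1) freq D j * j%:R ^+ i
    = \sum_(j < n.+1) (nperm_at j)%:R / (n`!)%:R * j%:R ^+ i.

End PermDesign.

(* Main.v *)
From HB Require Import structures.
Require Import Defs.
From mathcomp Require Import alt.

(** For a subgroup [D], the power sums of the distances are the moments of
    [n - nfix s] for [s] uniform in [D].  The moments of order at most [t] and
    the factorial moments of [nfix] of order at most [t] determine each other.
    Since [nfix s ^_ k] counts the [k]-tuples of distinct points fixed by [s],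
    Cauchy-Frobenius identifies the [k]-th factorial moment with the number of
    [D]-orbits on such tuples, which is [1] for the symmetric group if
    [k <= n].  So being a [t]-design says that this number is [1] for all
    [k <= t]. *)

Set Implicit Arguments.
Unset Strict Implicit.
Unset Printing Implicit Defensive.

Import GroupScope GRing.Theory Num.Theory.
Local Open Scope ring_scope.

(** The [q i] form a triangular basis: subtracting a suitable multiple of [q m] cancels the
    coefficient of degree [m], which lowers the size bound by one. *)
Lemma eq_scalar_graded (F : fieldType) (f g : {scalar {poly F}})
    (q : nat -> {poly F}) (t : nat) :
    (forall i, (i <= t)%N -> size (q i) = i.+1) ->
    (forall i, (i <= t)%N -> f (q i) = g (q i)) ->
  forall p : {poly F}, (size p <= t.+1)%N -> f p = g p.
Proof.
move=> size_q eq_fg p; move: {-2}t.+1 (leqnn t.+1) => m.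
elim: m => [|m IHm] in p *.
  by rewrite size_poly_leq0 => _ /eqP->; rewrite !linear0.
move=> lt_mt le_pm; set c := p`_m / lead_coef (q m).
have qm_neq0 : lead_coef (q m) != 0.
  by rewrite lead_coef_eq0 -size_poly_eq0 size_q.
rewrite -(subrK (c *: q m) p); set r := p - _.
rewrite linearD [RHS]linearD !linearZ /= eq_fg //; congr (_ + _).
apply: IHm; first exact: ltnW.
apply/leq_sizeP => j; rewrite leq_eqVlt coefB coefZ => /predU1P[<- | lt_mj].
  have -> : (q m)`_m = lead_coef (q m) by rewrite lead_coefE size_q.
  by rewrite divfK ?subrr.
by rewrite !nth_default ?mulr0 ?subr0 ?size_q ?(leq_trans le_pm).
Qed.

Definition ffact_poly (F : fieldType) (k : nat) : {poly F} :=
  \prod_(i <- iota 0 k) ('X - i%:R%:P).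

Lemma size_ffact_poly (F : fieldType) k : size (ffact_poly F k) = k.+1.
Proof. by rewrite size_prod_XsubC size_iota. Qed.

Lemma horner_ffact_poly (F : fieldType) k m :
  (ffact_poly F k).[m%:R] = (m ^_ k)%:R.
Proof.
elim: k => [|k IHk]; first by rewrite /ffact_poly big_nil hornerC ffactn0.
rewrite /ffact_poly -addn1 iotaD big_cat big_seq1 /= hornerM IHk hornerXsubC.
(* The truncated [m - k] differs from the difference in [F] when [m < k], but then the factor
   [m ^_ k] is already zero. *)
rewrite addn1 ffactnSr natrM add0n; have [le_km | lt_mk] := leqP k m.
  by rewrite natrB.
by rewrite ffact_small // !mul0r.
Qed.

Section FixMean.

Variable n : nat.
Implicit Types (D : {set 'S_n}) (G : {group 'S_n}) (p : {poly rat}).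

Definition fixmean D p : rat :=
  (\sum_(s in D) p.[(nfix s)%:R]) / #|D|%:R.

Lemma fixmean_is_scalar D : scalar (fixmean D).
Proof.
move=> a p q; rewrite /fixmean mulrA mulr_sumr -mulrDl -big_split /=.
by congr (_ / _); apply: eq_bigr => s _; rewrite hornerD hornerZ.
Qed.

HB.instance Definition _ D :=
  GRing.isLinear.Build rat {poly rat} rat *%R (fixmean D) (fixmean_is_scalar D).

Lemma nfix_le (s : 'S_n) : (nfix s <= n)%N.
Proof. by rewrite -[leqRHS]card_ord max_card. Qed.

(** Its value at [nfix s] is the [i]-th power of the distance from [s] to the identity. *)
Definition shift_poly (i : nat) : {poly rat} := (n%:R%:P - 'X) ^+ i.

Lemma size_shift_poly i : size (shift_poly i) = i.+1.
Proof. by rewrite /shift_poly -opprB exprNn size_Msign size_exp_XsubC. Qed.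

Lemma horner_shift_poly i (s : 'S_n) :
  (shift_poly i).[(nfix s)%:R] = (n - nfix s)%:R ^+ i.
Proof.
by rewrite horner_exp hornerD hornerN hornerC hornerX natrB ?nfix_le.
Qed.

Lemma sum_card_fiber (I : finType) (A : {pred I}) (d : I -> nat)
    (e : nat -> rat) :
    (forall x, x \in A -> (d x <= n)%N) ->
  \sum_(j < n.+1) #|[set x in A | d x == j]|%:R * e j = \sum_(x in A) e (d x).
Proof.
move=> le_dn.
rewrite (partition_big (fun x => inord (d x) : 'I_n.+1) predT) //=.
apply: eq_bigr => j _; rewrite -sum1_card natr_sum mulr_suml.
apply: eq_big => x; rewrite !inE.
  by case Ax: (x \in A); rewrite //= -val_eqE /= inordK // ltnS le_dn.
by case/andP=> _ /eqP->; rewrite mul1r.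
Qed.

Lemma sum_freq G i :
  \sum_(j < n.+1) freq G j * j%:R ^+ i = fixmean G (shift_poly i).
Proof.
under eq_bigr => j _ do rewrite /freq mulrAC.
rewrite -mulr_suml.
pose d (p : 'S_n * 'S_n) := dS p.1 p.2.
have -> : \sum_(j < n.+1) #|[set p : 'S_n * 'S_n |
      [&& p.1 \in G, p.2 \in G & dS p.1 p.2 == j]]|%:R * j%:R ^+ i
    = \sum_(p in setX G G) (d p)%:R ^+ i :> rat.
  rewrite -(@sum_card_fiber _ _ d (fun j => j%:R ^+ i)) => [|p _];
    last exact: leq_subr.
  apply: eq_bigr => j _; congr (_%:R * _); apply: eq_card => p.
  by rewrite !inE andbA.
have -> : \sum_(p in setX G G) (d p)%:R ^+ i
    = \sum_(u in G) \sum_(s in G) (n - nfix s)%:R ^+ i :> rat.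
  rewrite exchange_big pair_big_dep /=.
  (* Right invariance of the distance: the pair [(s * u, u)] lies at distance [n - nfix s], whatever
     [u] is. The sum over [u] then cancels one factor of [#|G| ^ 2]. *)
  rewrite (reindex_onto (fun w => (w.1 * w.2, w.2)%g)
    (fun w => (w.1 * w.2^-1, w.2)%g)).
    apply: eq_big => -[s u] /=; last by rewrite /d /dS /= mulgK.
    rewrite !inE /= mulgK eqxx andbT andbC [RHS]andbC.
    by case Gu: (u \in G); rewrite //= groupMr.
  by case=> s u _ /=; rewrite mulgKV.
rewrite sumr_const -[_ *+ #|G|]mulr_natr /fixmean natrX expr2 invfM mulrA mulfK;
  last by rewrite pnatr_eq0 -lt0n cardG_gt0.
by congr (_ / _); apply: eq_bigr => s _; rewrite horner_shift_poly.
Qed.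

Lemma sum_nperm_at i :
  \sum_(j < n.+1) (nperm_at n j)%:R / (n`!)%:R * j%:R ^+ i
  = fixmean setT (shift_poly i).
Proof.
under eq_bigr => j _ do rewrite mulrAC.
rewrite -mulr_suml /fixmean cardsT card_Sn; congr (_ / _).
under [RHS]eq_bigr => s _ do rewrite horner_shift_poly.
rewrite -(@sum_card_fiber _ _ _ (fun j => j%:R ^+ i)) => [|s _];
  last exact: leq_subr.
apply: eq_bigr => j _; congr (_%:R * _); apply: eq_card => s.
rewrite !inE; have := nfix_le s; have := ltn_ord j; rewrite ltnS => le_jn le_sn.
by apply/eqP/eqP => [-> | <-]; rewrite subKn.
Qed.

(** The case [i = 0] is automatic, both means being 1; including it gives a test polynomial in every
    degree up to [t], as [eq_scalar_graded] requires. *)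
Lemma is_designE t G :
  is_design t G <-> forall i, (i <= t)%N ->
    fixmean G (shift_poly i) = fixmean setT (shift_poly i).
Proof.
split=> [[_ eqG] i le_it | eqG].
  case: i le_it => [_ | i le_it]; last by rewrite -sum_freq -sum_nperm_at eqG.
  have mean1 (H : {group 'S_n}) : fixmean H (shift_poly 0) = 1.
    rewrite /fixmean /shift_poly expr0; under eq_bigr => s _ do rewrite hornerC.
    by rewrite sumr_const divff // pnatr_eq0 -lt0n cardG_gt0.
  by rewrite mean1 -[setT]/(gval [set: 'S_n]%G) mean1.
split=> [|i /andP[_ le_it]]; first by apply/set0Pn; exists 1%g; apply: group1.
by rewrite sum_freq sum_nperm_at eqG.
Qed.

(** A tuple is fixed exactly when all its entries are, so these are the repetition-free words of
    length [k] over the fixed points of [s]. *)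
Lemma card_fixed_dtuples k (s : 'S_n) :
  #|'Fix_(k.-dtuple([set: 'I_n]) | 'P * k)[s]| = nfix s ^_ k.
Proof.
rewrite /nfix -cardsE -card_uniq_tuples; apply: eq_card => u.
rewrite !inE sub1set inE (introT subsetP) => [|x _]; last exact: in_setT.
rewrite andbT andbC -val_eqE /=; congr (_ && _).
elim: (val u) => //= x r IHr; rewrite eqseq_cons IHr; congr (_ && _).
by rewrite -[RHS]/(x \in [set y | s y == y]) inE.
Qed.

Lemma acts_dtuples k G : [acts G, on k.-dtuple([set: 'I_n]) | 'P * k].
Proof.
apply/subsetP => s _; rewrite !inE; apply/subsetP => u Su; rewrite inE.
by apply: n_act_dtuple Su; rewrite !inE; apply/subsetP => x; rewrite !inE.
Qed.

Lemma fixmean_ffact k G :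
  fixmean G (ffact_poly rat k)
  = #|orbit ('P * k) G @: k.-dtuple([set: 'I_n])|%:R.
Proof.
rewrite /fixmean.
under eq_bigr => s _ do rewrite horner_ffact_poly -card_fixed_dtuples.
rewrite -natr_sum Frobenius_Cauchy ?acts_dtuples // natrM mulfK //.
by rewrite pnatr_eq0 -lt0n cardG_gt0.
Qed.

(** Transitivity means that there is exactly one orbit. For [k > n] both sides fail: there is no
    tuple, hence no orbit, while [atrans] asks the whole set to be an orbit. *)
Lemma ntransitiveE k G :
  [transitive^k G, on [set: 'I_n] | 'P] <-> fixmean G (ffact_poly rat k) = 1.
Proof.
rewrite fixmean_ffact; split=> [trG | /eqP].
  suffices -> : orbit ('P * k) G @: k.-dtuple([set: 'I_n])
      = [set k.-dtuple([set: 'I_n])] by rewrite cards1.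
  apply/eqP; rewrite eqEsubset sub1set [_ \in _]trG andbT.
  by apply/subsetP => _ /imsetP[u Su ->]; rewrite inE (atransP trG).
rewrite pnatr_eq1 => /cards1P[O defO].
have := cover_partition (orbit_partition (acts_dtuples k G)).
by rewrite defO cover1 /ntransitive /atrans defO => ->; rewrite inE.
Qed.

Lemma fixmean_ffact_Sym k :
  (k <= n)%N -> fixmean setT (ffact_poly rat k) = 1.
Proof.
move=> le_kn; apply/(ntransitiveE k [set: 'S_n]%G).
apply: (ntransitive_weak _ (Sym_trans 'I_n)).
by rewrite card_ord.
Qed.

End FixMean.

Local Close Scope ring_scope.

Theorem theorem2 (t n : nat) (t_gt0 : 1 <= t) (n_gt0 : 1 <= n) :
  (forall D : {group 'S_n},
     [transitive ^ t D, on [set: 'I_n] | 'P] -> is_design t D)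
  /\
  (forall D : {group 'S_n},
     t <= n -> is_design t D -> [transitive ^ t D, on [set: 'I_n] | 'P]).
Proof.
split=> D => [trD | le_tn].
  have le_tn : t <= n.
    (* Transitivity provides a tuple [u] of [t] distinct points. *)
    case/imsetP: (trD) => u; rewrite inE => /andP[Uu _] _.
    by rewrite -(size_tuple u) -(card_uniqP Uu) -[leqRHS]card_ord max_card.
  apply/is_designE => i le_it.
  (* The means are compared on falling factorials here, and on powers of [n - 'X] in the
     converse. *)
  apply: (eq_scalar_graded (t := t) (fun k _ => size_ffact_poly _ k))
    => [k le_kt|] /=.
    rewrite fixmean_ffact_Sym ?(leq_trans le_kt) //.
    by apply/ntransitiveE; apply: ntransitive_weak trD.
  by rewrite size_shift_poly ltnS.
move/is_designE => eqD; apply/ntransitiveE.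
(* The bound [t <= n] enters here: for [t > n] the mean over [setT] would be 0, and the symmetric
   group is a design without being [t]-transitive. *)
rewrite -(fixmean_ffact_Sym le_tn).
apply: (eq_scalar_graded (fun k _ => size_shift_poly n k) eqD).
by rewrite size_ffact_poly.
Qed.
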